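(* Let $(R,\mathfrak{m})$ be a one-dimensional (Noetherian) Cohen-Macaulay local ring whose residue field has characteristic $0$. Let $I$ be an $\mathfrak{m}$-primary ideal, and let $B$ be the blowup of $I$. Let $K$ be the conductor of $B$ into $R$, and let $x\in I$ be an arbitrary element such that $(x)$ is a minimal reduction of $I$. Then $$\operatorname{core}(I)=xK=IK.$$
   Context: An ideal $J\subseteq I$ is a reduction of $I$ if $JI^n=I^{n+1}$ for some integer $n$; a minimal reduction is a reduction minimal with respect to inclusion. $\operatorname{core}(I)$ is the intersection of all reductions of $I$. The blowup of $I$ is the ring $B=B(I)=\bigcup_{n\ge1}(I^n:_FI^n)$, where $F$ is the (total) ring of fractions of $R$. The conductor of $B$ into $R$ is $K=\{a\in R\mid aB\subseteq R\}$. *)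

(* Defs.v *)
From HB Require Import structures.
From mathcomp Require Import all_boot all_order all_algebra.
From mathcomp Require Import boolp classical_sets.

Set Implicit Arguments.
Unset Strict Implicit.
Unset Printing Implicit Defensive.

Import GRing.Theory.
Local Open Scope ring_scope.
Local Open Scope classical_set_scope.

(* Ideals are Prop-valued sets: MathComp's idealr structure is boolean and only
   covers proper ideals, whereas the unit ideal is needed here (I^0, and the
   conductor when B = R). *)

Section Ideals.
Variable R : comNzRingType.
Implicit Types (I J P M : set R) (a b r x z : R).

Definition is_ideal J : Prop :=
  [/\ J 0, (forall a b, J a -> J b -> J (a + b)) &
      (forall r a, J a -> J (r * a))].

Definition is_proper_ideal J : Prop := is_ideal J /\ ~ J 1.

Definition is_prime_ideal P : Prop :=
  is_proper_ideal P /\ forall a b, P (a * b) -> P a \/ P b.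

Definition is_maximal_ideal M : Prop :=
  is_proper_ideal M /\
  forall J, is_proper_ideal J -> M `<=` J -> J = M.

Definition ideal_gen (A : set R) : set R :=
  \bigcap_(J in [set J | is_ideal J /\ A `<=` J]) J.

Definition idealM I J : set R := ideal_gen [set a * b | a in I & b in J].

Definition idealX I (n : nat) : set R := iter n (idealM I) setT.

Definition radical I : set R := [set a | exists n : nat, I (a ^+ n)].

Definition is_primary_ideal I : Prop :=
  is_proper_ideal I /\ forall a b, I (a * b) -> I a \/ radical I b.

Definition is_primary_to M I : Prop := is_primary_ideal I /\ radical I = M.

Definition is_local_ring M : Prop :=
  is_maximal_ideal M /\ forall N, is_maximal_ideal N -> N = M.

(* p 0 < p 1 < ... < p n; the values of p beyond n are irrelevant. *)
Definition is_prime_chain (n : nat) (p : nat -> set R) : Prop :=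
  (forall i : nat, (i <= n)%N -> is_prime_ideal (p i)) /\
  (forall i : nat, (i < n)%N -> p i `<` p i.+1).

(* The i-th element is a nonzerodivisor modulo the preceding ones, and the
   sequence does not generate the unit ideal. *)
Definition is_regular_seq (s : seq R) : Prop :=
  (forall (i : nat) r, (i < size s)%N ->
     ideal_gen [set` take i s] (s`_i * r) -> ideal_gen [set` take i s] r) /\
  ~ ideal_gen [set` s] 1.

Definition depth_eq M (d : nat) : Prop :=
  (exists s : seq R, [/\ size s = d, [set` s] `<=` M & is_regular_seq s]) /\
  (forall s : seq R, [set` s] `<=` M -> is_regular_seq s -> (size s <= d)%N).

Definition nonzerodivisor a : Prop := forall b, a * b = 0 -> b = 0.

Definition is_reduction J I : Prop :=
  [/\ is_ideal J, J `<=` I &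
      exists n : nat, idealM J (idealX I n) = idealX I n.+1].

Definition is_minimal_reduction J I : Prop :=
  is_reduction J I /\
  forall J', is_reduction J' I -> J' `<=` J -> J' = J.

Definition core I : set R := \bigcap_(J in [set J | is_reduction J I]) J.

End Ideals.

Definition is_noetherian (R : comNzRingType) : Prop :=
  forall J : set R, is_ideal J -> exists s : seq R, J = ideal_gen [set` s].

Definition krull_dim_eq (R : comNzRingType) (d : nat) : Prop :=
  (exists p : nat -> set R, is_prime_chain d p) /\
  (forall (n : nat) (p : nat -> set R), is_prime_chain n p -> (n <= d)%N).

(* For a Noetherian local ring R with maximal ideal M: depth R = dim R. *)
Definition is_cohen_macaulay (R : comNzRingType) (M : set R) : Prop :=
  exists d : nat, krull_dim_eq R d /\ depth_eq M d.

(* rho presents k as the quotient R / M. *)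
Definition is_residue_field (R : comNzRingType) (M : set R) (k : fieldType)
    (rho : {rmorphism R -> k}) : Prop :=
  (forall y : k, exists a : R, rho a = y) /\
  (forall a : R, rho a = 0 <-> M a).

(* iota presents F as the localization of R at its nonzerodivisors; this
   determines F up to a unique isomorphism over R. *)
Definition is_total_fraction_ring (R : comNzRingType) (F : comUnitRingType)
    (iota : {rmorphism R -> F}) : Prop :=
  [/\ injective iota,
      (forall s : R, nonzerodivisor s -> iota s \is a GRing.unit) &
      (forall z : F, exists a s : R, nonzerodivisor s /\ z = iota a / iota s)].

Section Blowup.
Variables (R : comNzRingType) (F : comUnitRingType).
Variable iota : {rmorphism R -> F}.

(* (I :_F J), where R is identified with its image in F. *)
Definition colonF (I J : set R) : set F :=
  [set z | forall a, J a -> (iota @` I) (z * iota a)].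

Definition blowup (I : set R) : set F :=
  \bigcup_(n in [set n : nat | (1 <= n)%N]) colonF (idealX I n) (idealX I n).

Definition conductor (B : set F) : set R :=
  [set a | forall b, B b -> range iota (iota a * b)].

End Blowup.

(* Main.v *)
Require Import Defs.
From mathcomp Require Import all_boot all_order all_algebra.
From mathcomp Require Import boolp classical_sets.
From mathcomp Require Import ring.

Set Implicit Arguments.
Unset Strict Implicit.
Unset Printing Implicit Defensive.

Import GRing.Theory.
Local Open Scope ring_scope.
Local Open Scope classical_set_scope.

(** Write [w = z / x] for [z] in [I].  The ring has positive depth, so [I]
    contains a nonzerodivisor; since [x I^n = I^(n+1)] for large [n], [x] is a
    nonzerodivisor too, and the blowup [B] is the increasing union of the
    fractional ideals [x^(-m) I^m]; hence [a] lies in the conductor [K] exactly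
    when [x^m] divides [a y] for all [m] and all [y] in [I^m]
    ([conductorP]).  The fraction ring then disappears and every assertion is
    one about divisibility by powers of [x] in [R].

    That [I K = x K] says that [K] is a [B]-module and [I B = x B].  For a
    reduction [J] with [J I^n = I^(n+1)], the element [x^(n+1)] is a sum of
    products [j y] with [j] in [J] and [y] in [I^n]; multiplying by [a] in [K]
    turns each [y] into a multiple of [x^n], so [a x] is in [J].  Thus [x K]
    lies in the core ([mul_mem_reduction]).

    Conversely let [x c] be in the core and let [w = z / x].  The ring is
    Noetherian, so [w] is a root of a monic polynomial [p] over [R]
    ([fraction_integral]), and [w - s] divides [p(s)] in [R[w]].  If [p(s)] is
    a unit of [R], then [w - s] is a unit of [R[w]], so [z - s x] generates
    another reduction of [I] and also divides [x c]: that is, [c / (w - s)] is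
    in [R].  Hence the polynomial [c (p(s) - p(w)) / (s - w)] in [s] takes
    values in [R] at every such [s].  The residue field has characteristic
    [0], so enough integers [s] with [p(s)] a unit have pairwise differences
    that are units ([interpolation_nodes]), and interpolation
    ([coef_ideal_of_values]) puts every coefficient of that polynomial in [R].
    These coefficients are [c] times the Horner partial values of [p] at [w],
    which span [R[w]]; so [c w^i] is in [R] for all [i] ([core_dvd_power]).

    It remains to pass from powers of one element of [I] to products of
    different elements.  This is polarization: the coefficient of [t] in
    [(z + b t)^(i+1)] is [(i+1) b z^i], interpolation isolates it, and [i+1]
    is a unit ([dvd_products_of_powers]). *)

(** * Ideals and their powers *)

Section Ideals.
Variable R : comNzRingType.
Implicit Types (I J L A : set R) (a b c d g r s x y z : R).

Definition invertible a : Prop := exists b, a * b = 1.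

Lemma idealN J a : is_ideal J -> J a -> J (- a).
Proof. by move=> [_ _ JM] Ja; rewrite -mulN1r; apply: JM. Qed.

Lemma idealB J a b : is_ideal J -> J a -> J b -> J (a - b).
Proof. by move=> JI Ja Jb; case: (JI) => _ + _; apply => //; apply: idealN. Qed.

Lemma idealMr J r a : is_ideal J -> J a -> J (a * r).
Proof. by move=> [_ _ JM] Ja; rewrite mulrC; apply: JM. Qed.

Lemma ideal_sum J n (f : 'I_n -> R) :
  is_ideal J -> (forall i, J (f i)) -> J (\sum_(i < n) f i).
Proof. by move=> [J0 JD _] Jf; apply: (big_ind J). Qed.

Lemma ideal_cancel J u a : is_ideal J -> invertible u -> J (u * a) -> J a.
Proof.
by move=> [_ _ JM] [v uv1] /(JM v); rewrite mulrA (mulrC v) uv1 mul1r.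
Qed.

Lemma ideal_transporter L b : is_ideal L -> is_ideal [set a | L (a * b)].
Proof.
move=> [L0 LD LM]; split=> /=; first by rewrite mul0r.
- by move=> a a' La La'; rewrite mulrDl; apply: LD.
- by move=> r a La; rewrite -mulrA; apply: LM.
Qed.

Lemma setT_ideal : is_ideal [set: R]. Proof. by []. Qed.

Lemma ideal_gen_ideal A : is_ideal (ideal_gen A).
Proof.
split.
- by move=> J [[]].
- move=> a b Ga Gb J JA; case: (JA) => -[_ JD _] _.
  by apply: JD; [apply: Ga|apply: Gb].
- by move=> r a Ga J JA; case: (JA) => -[_ _ JM] _; apply: JM; apply: Ga.
Qed.

Lemma sub_ideal_gen A : A `<=` ideal_gen A.
Proof. by move=> a Aa J [_]; apply. Qed.

Lemma ideal_gen_sub A J : is_ideal J -> A `<=` J -> ideal_gen A `<=` J.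
Proof. by move=> JI AJ a Aa; apply: Aa. Qed.

(** Divisibility by [x] is membership in this ideal throughout, so that closure
    under the ideal operations comes for free. *)
Lemma ideal_gen1P x a : ideal_gen [set x] a <-> exists r, a = x * r.
Proof.
split; last first.
  by move=> [r ->]; apply: (idealMr _ (ideal_gen_ideal _)); apply: sub_ideal_gen.
apply: (@ideal_gen_sub _ [set a | exists r, a = x * r]); last first.
  by move=> _ ->; exists 1; rewrite mulr1.
split=> /=; first by exists 0; rewrite mulr0.
- by move=> _ _ [r ->] [r' ->]; exists (r + r'); rewrite mulrDr.
- by move=> t _ [r ->]; exists (t * r); rewrite mulrCA.
Qed.

Lemma mem_idealM I J a b : I a -> J b -> idealM I J (a * b).
Proof. by move=> Ia Jb; apply: sub_ideal_gen; exists a => //; exists b. Qed.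

Lemma idealM_sub I J L : is_ideal L ->
  (forall a b, I a -> J b -> L (a * b)) -> idealM I J `<=` L.
Proof. by move=> LI LM; apply: ideal_gen_sub => // _ [a Ia [b Jb <-]]; apply: LM. Qed.

Lemma idealX_ideal I n : is_ideal (idealX I n).
Proof. by case: n => [|n]; [apply: setT_ideal|apply: ideal_gen_ideal]. Qed.

Lemma idealXD I m n a b :
  idealX I m a -> idealX I n b -> idealX I (m + n) (a * b).
Proof.
elim: m a => [|m IHm] a; first by move=> _; case: (idealX_ideal I n) => _ _; apply.
move=> Ia Ib; apply: (idealM_sub (ideal_transporter b (idealX_ideal I (m.+1 + n))) _ Ia).
by move=> i c Ii Ic /=; rewrite -mulrA; apply: mem_idealM => //; apply: IHm.
Qed.

Lemma idealX1 I : I `<=` idealX I 1.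
Proof. by move=> a Ia; rewrite -[a]mulr1; apply: mem_idealM. Qed.

Lemma idealX_exp I x n : I x -> idealX I n (x ^+ n).
Proof. by move=> Ix; elim: n => // n IHn; rewrite exprS; apply: mem_idealM. Qed.

Lemma nonzerodivisor_inj x a b : nonzerodivisor x -> x * a = x * b -> a = b.
Proof. by move=> xreg /eqP; rewrite -subr_eq0 -mulrBr => /eqP/xreg/subr0_eq. Qed.

Lemma nonzerodivisorX x n : nonzerodivisor x -> nonzerodivisor (x ^+ n).
Proof.
move=> xreg; elim: n => [|n IHn] b; first by rewrite mul1r.
by rewrite exprS -mulrA => /xreg/IHn.
Qed.

Lemma dvd_cancel x n a b : nonzerodivisor x ->
  ideal_gen [set b * x ^+ n] (a * x ^+ n) -> ideal_gen [set b] a.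
Proof.
move=> xreg /ideal_gen1P[r]; rewrite mulrAC ![_ * x ^+ n]mulrC => Ea.
apply/ideal_gen1P; exists r.
by apply: (nonzerodivisor_inj (@nonzerodivisorX _ n xreg)).
Qed.

(** * Interpolation modulo an ideal *)

(** Lagrange interpolation modulo [J], where the quotient need not be a domain:
    splitting off the root [t] modulo [J] leaves a quotient whose values at
    the other nodes [u] are in [J] because [u - t] can be cancelled. *)
Lemma coef_ideal_of_values J (nodes : seq R) (p : {poly R}) :
  is_ideal J -> uniq nodes ->
  {in nodes &, forall s t, s != t -> invertible (t - s)} ->
  (size p <= size nodes)%N -> (forall t, t \in nodes -> J p.[t]) ->
  forall i, J p`_i.
Proof.
move=> JI; case: (JI) => J0 JD JM.
elim: nodes p => [|t s IHs] p /=.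
  by move=> _ _; rewrite leqn0 size_poly_eq0 => /eqP -> _ i; rewrite coef0.
move=> /andP[tNs Us] unit_diff size_p Jp i.
have /factor_theorem[q Eq] : root (p - p.[t]%:P) t.
  by rewrite rootE !hornerE subrr.
have Ep : p = q * ('X - t%:P) + p.[t]%:P by rewrite -Eq subrK.
have Jpt : J p.[t] by apply: Jp; rewrite mem_head.
have Jq : forall j, J q`_j.
  apply: IHs => // [u v us vs| |u us].
  - by apply: unit_diff; rewrite inE ?us ?vs orbT.
  - have [->|q0] := eqVneq q 0; first by rewrite size_poly0.
    have := size_Mmonic q0 (monicXsubC t); rewrite -Eq size_XsubC addn2 /= => Es.
    have : (size (p - p.[t]%:P)%R <= (size s).+1)%N.
      rewrite (leq_trans (size_polyD _ _)) // size_polyN geq_max size_p.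
      by rewrite (leq_trans (size_polyC_leq1 _)).
    by rewrite Es.
  - have tu : t != u by apply: contraNneq tNs => ->.
    apply: (@ideal_cancel _ (u - t)) => //.
      by apply: unit_diff => //; rewrite inE ?eqxx ?us ?orbT.
    have -> : (u - t) * q.[u] = p.[u] - p.[t].
      by rewrite {1}Ep !hornerE; ring.
    by apply: idealB => //; apply: Jp; rewrite inE us orbT.
rewrite Ep mulrBr coefD coefB coefMX coefMC coefC; apply: JD.
  apply: idealB => //; first by case: ifP.
  exact: idealMr.
by case: ifP.
Qed.

(** The coefficient of [t] in [g * (z + a * t) ^+ m.+1] is
    [m.+1 * (g * a * z ^+ m)]. *)
Lemma linear_coef_ideal J (nodes : seq R) m g a z :
  is_ideal J -> uniq nodes ->
  {in nodes &, forall s t, s != t -> invertible (t - s)} ->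
  (m.+2 <= size nodes)%N -> invertible (m.+1)%:R ->
  (forall t, J (g * (z + a * t) ^+ m.+1)) -> J (g * a * z ^+ m).
Proof.
move=> JI Us Ds size_s unit_m Jt.
pose p := \poly_(i < m.+2) (g * (z ^+ (m.+1 - i) * a ^+ i) *+ 'C(m.+1, i)).
have Jp : J p`_1.
  apply: (coef_ideal_of_values JI Us Ds).
    by apply: leq_trans size_s; apply: size_poly.
  move=> t _; rewrite horner_poly; have := Jt t; rewrite exprDn mulr_sumr.
  congr J; apply: eq_bigr => i _.
  by rewrite mulrnAl mulrnAr exprMn !mulrA.
apply: (ideal_cancel JI unit_m); move: Jp; rewrite coef_poly /= bin1 subSS subn0.
by rewrite mulr_natl -mulrA (mulrC a).
Qed.

End Ideals.
Arguments invertible {R} a.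
Arguments nonzerodivisorX {R x} n _ [b].

(** * Units of a local ring with residue field of characteristic zero *)

Section Local.
Variable R : comNzRingType.
Implicit Types (M J : set R).

Lemma proper_ideal_sub_maximal J :
  is_proper_ideal J -> exists2 N, is_maximal_ideal N & J `<=` N.
Proof.
move=> Jproper.
(* The empty set is added so that the empty chain has an upper bound. *)
pose P (A : set R) := A = set0 \/ (is_proper_ideal A /\ J `<=` A).
have /Zorn_bigcup[N [PN Nmax]] : forall C : set (set R),
    C `<=` P -> total_on C subset -> P (\bigcup_(A in C) A).
  move=> C CP Ctot; have [[A [CA A0]]|noA] := pselect (exists A, C A /\ A !=set0).
    right.
    have PC B b : C B -> B b -> is_proper_ideal B /\ J `<=` B.
      by move=> CB Bb; case: (CP B CB) => // B0; move: Bb; rewrite B0.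
    case: A0 => a0 Aa0; have [[[A0 AD AM] A1] JA] := PC _ _ CA Aa0.
    split; last by move=> j Jj; exists A => //; apply: JA.
    split; last by move=> [B CB B1]; case: (PC _ _ CB B1) => -[].
    split; first by exists A.
      move=> a b [B CB Ba] [B' CB' B'b].
      have [BB'|B'B] := Ctot _ _ CB CB'.
        have [[[_ BD _] _] _] := PC _ _ CB' B'b.
        by exists B' => //; apply: BD => //; apply: BB'.
      have [[[_ BD _] _] _] := PC _ _ CB Ba.
      by exists B => //; apply: BD => //; apply: B'B.
    move=> r a [B CB Ba]; exists B => //.
    by have [[[_ _ BM] _] _] := PC _ _ CB Ba; apply: BM.
  left; rewrite predeqE => a; split=> // -[A CA Aa].
  by case: noA; exists A; split=> //; exists a.
have N0 : N !=set0.
  apply/set0P; apply/eqP => N0; apply: (Nmax J); last by right; split.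
  rewrite N0; split=> // J_empty.
  by have [[J0 _ _] _] := Jproper; apply: (J_empty 0 J0).
case: PN => [NE|[Nproper JN]]; first by case: N0 => a; rewrite NE.
exists N => //; split=> // N' N'proper NN'.
apply: contrapT => neq; apply: (Nmax N'); last first.
  by right; split=> //; apply: subset_trans NN'.
split=> // N'N; apply: neq; exact/seteqP.
Qed.

Lemma local_invertible M a : is_local_ring M -> ~ M a -> invertible a.
Proof.
move=> [_ Muniq] NMa; apply: contrapT => a_nunit.
have aproper : is_proper_ideal (ideal_gen [set a]).
  split; first exact: ideal_gen_ideal.
  by move=> /ideal_gen1P[b ab1]; apply: a_nunit; exists b.
have [N /Muniq -> aN] := proper_ideal_sub_maximal aproper.
by apply: NMa; apply: aN; apply: sub_ideal_gen.
Qed.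

Variables (k : fieldType) (rho : {rmorphism R -> k}).
Hypothesis rho_local : forall a, rho a != 0 -> invertible a.
Hypothesis pchar0 : [pchar k] =i pred0.

Lemma natr_inj_pchar0 : injective (fun n : nat => n%:R : k).
Proof.
have natr0 := (pcharf0P k).1 pchar0.
suff le m n : (m%:R : k) = n%:R -> (m <= n)%N.
  by move=> m n /= Emn; apply/eqP; rewrite eqn_leq !le.
move=> Emn; rewrite leqNgt; apply/negP => ltnm.
have : ((m - n)%N%:R : k) = 0.
  by apply: (addrI (n%:R)); rewrite -natrD (subnKC (ltnW ltnm)) Emn addr0.
by move/eqP; rewrite natr0 subn_eq0 leqNgt ltnm.
Qed.

Lemma natrS_invertible n : invertible (n.+1%:R : R).
Proof. by apply: rho_local; rewrite rmorph_nat ((pcharf0P k).1 pchar0). Qed.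

(** The nodes are natural numbers: they stay distinct in [k], and only
    finitely many of them are roots of the reduction of [p], so enough remain
    among the first [n + size p] ones. *)
Lemma interpolation_nodes (p : {poly R}) n : map_poly rho p != 0 ->
  exists nodes : seq R, [/\ uniq nodes, (n <= size nodes)%N,
    {in nodes &, forall s t, s != t -> invertible (t - s)} &
    forall t, t \in nodes -> invertible p.[t]].
Proof.
move=> p0; set P := map_poly rho p in p0 *.
pose ns := iota 0 (n + size P).
pose good (i : nat) := ~~ root P i%:R.
exists [seq i%:R | i <- ns & good i]; split.
- rewrite map_inj_uniq ?filter_uniq ?iota_uniq // => i j Eij.
  by apply: natr_inj_pchar0; rewrite -!(rmorph_nat rho) Eij.
- rewrite size_map size_filter.
  have := count_predC good ns; rewrite size_iota => Ec.
  have : (count (predC good) ns < size P)%N.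
    rewrite -size_filter -(size_map (fun i : nat => i%:R : k)).
    apply: max_poly_roots => //.
      apply/allP => _ /mapP[i + ->]; rewrite mem_filter => /andP[].
      by rewrite /= negbK.
    by rewrite map_inj_uniq ?filter_uniq ?iota_uniq //; apply: natr_inj_pchar0.
  by move=> lt; rewrite -(leq_add2r (size P)) -Ec leq_add2l ltnW.
- move=> _ _ /mapP[i _ ->] /mapP[j _ ->] neq; apply: rho_local.
  rewrite rmorphB !rmorph_nat subr_eq0; apply: contraNneq neq.
  by move/natr_inj_pchar0 ->.
- move=> _ /mapP[i + ->]; rewrite mem_filter => /andP[gi _].
  by apply: rho_local; rewrite -horner_map rmorph_nat.
Qed.

End Local.

(** * Powers of an ideal with a principal reduction *)

Section PrincipalReduction.
Variable R : comNzRingType.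
Implicit Types (I J L : set R) (a c g v x y z : R).

Lemma mem_reduction_ideal I n x y :
  idealM (ideal_gen [set x]) (idealX I n) y ->
  exists2 v, idealX I n v & y = x * v.
Proof.
apply: (@idealM_sub _ _ _ [set y | exists2 v, idealX I n v & y = x * v]).
  have [I0 ID IM] := idealX_ideal I n; split=> /=.
  - by exists 0; rewrite ?mulr0.
  - by move=> _ _ [v Iv ->] [w Iw ->]; exists (v + w); [apply: ID|rewrite mulrDr].
  - by move=> r _ [v Iv ->]; exists (r * v); [apply: IM|rewrite mulrCA].
move=> _ b /ideal_gen1P[r ->] Ib; exists (r * b); last by rewrite mulrA.
by case: (idealX_ideal I n) => _ _; apply.
Qed.

(** From the reduction exponent on, [I^(m + n) = x^m I^n]; this is what makes
    [I^n / x^n] independent of [n] and equal to the blowup. *)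
Lemma idealX_factor I n0 x :
  idealM (ideal_gen [set x]) (idealX I n0) = idealX I n0.+1 ->
  forall m n y, (n0 <= n)%N -> idealX I (m + n) y ->
    exists2 v, idealX I n v & y = x ^+ m * v.
Proof.
move=> red.
have step n y : (n0 <= n)%N -> idealX I n.+1 y ->
    exists2 v, idealX I n v & y = x * v.
  move=> /subnK <-; elim: (n - n0)%N y => [|j IHj] y.
    by rewrite -[in X in X -> _]red; apply: mem_reduction_ideal.
  rewrite !addSn => Iy; apply: mem_reduction_ideal.
  move: Iy; apply: idealM_sub; first exact: ideal_gen_ideal.
  move=> a b Ia /IHj[v Iv ->]; rewrite mulrCA.
  apply: mem_idealM; first exact: sub_ideal_gen.
  exact: mem_idealM.
elim=> [|m IHm] n y le_n Iy; first by exists y; rewrite ?mul1r.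
have [v Iv ->] := step _ _ (leq_trans le_n (leq_addl m n)) Iy.
have [w Iw ->] := IHm n v le_n Iv.
by exists w; rewrite // exprS mulrA.
Qed.

(** If [x^(N+1)] lies in [y I^N], then [I^(N+1+n0) = x^(N+1) I^n0] is
    contained in [y I^(N+n0)]. *)
Lemma principal_reduction I n0 x y N :
  is_ideal I -> I y ->
  idealM (ideal_gen [set x]) (idealX I n0) = idealX I n0.+1 ->
  (exists2 h, idealX I N h & x ^+ N.+1 = y * h) ->
  is_reduction (ideal_gen [set y]) I.
Proof.
move=> II Iy red [h Ih Exh]; have yI : ideal_gen [set y] `<=` I.
  by apply: ideal_gen_sub => // _ ->.
split=> //; first exact: ideal_gen_ideal.
exists (N + n0)%N; apply/seteqP; split=> v.
  apply: idealM_sub; first exact: (idealX_ideal I (N + n0).+1).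
  by move=> a b /yI Ia Ib; apply: mem_idealM.
rewrite -addSn => /(idealX_factor red (leqnn n0))[w Iw ->].
rewrite Exh -mulrA; apply: mem_idealM; first exact: sub_ideal_gen.
exact: idealXD.
Qed.

(** The ascending chain of the ideals [(e 0, ..., e (n-1))] is stationary. *)
Lemma noetherian_relation (e : nat -> R) : is_noetherian R ->
  exists N (r : nat -> R), e N = \sum_(i < N) r i * e i.
Proof.
move=> noeth.
pose E n : set R := [set a | exists r : nat -> R, a = \sum_(i < n) r i * e i].
have E_ideal n : is_ideal (E n).
  split=> /=.
  - by exists (fun=> 0); rewrite big1 // => i _; rewrite mul0r.
  - move=> _ _ [r ->] [s ->]; exists (fun i => r i + s i).
    by rewrite -big_split; apply: eq_bigr => i _; rewrite mulrDl.
  - move=> t _ [r ->]; exists (fun i => t * r i).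
    by rewrite mulr_sumr; apply: eq_bigr => i _; rewrite mulrA.
have E_mono m n : (m <= n)%N -> E m `<=` E n.
  move=> /subnKC <- _ [r ->]; exists (fun i => if (i < m)%N then r i else 0).
  rewrite big_split_ord /= [X in _ + X]big1 => [|i _]; last first.
    by rewrite ltnNge leq_addr mul0r.
  by rewrite addr0; apply: eq_bigr => i _; rewrite ltn_ord.
have E_self n : E n.+1 (e n).
  exists (fun i => (i == n)%:R); rewrite big_ord_recr /= eqxx mul1r big1 ?add0r //.
  by move=> i _; rewrite ltn_eqF ?mul0r.
have [|s Es] := noeth (\bigcup_n E n).
  split; first by exists 0%N => //; case: (E_ideal 0%N).
    move=> a b [m _ Ea] [n _ Eb]; exists (maxn m n) => //.
    case: (E_ideal (maxn m n)) => _ ED _; apply: ED.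
      by move: Ea; apply: E_mono; apply: leq_maxl.
    by move: Eb; apply: E_mono; apply: leq_maxr.
  by move=> r a [n _ Ea]; exists n => //; case: (E_ideal n) => _ _; apply.
have [N sN] : exists N, [set` s] `<=` E N.
  have : [set` s] `<=` \bigcup_n E n by rewrite Es; apply: sub_ideal_gen.
  elim: s {Es} => [|a s IHs] sE; first by exists 0%N.
  have [|N sN] := IHs.
    by move=> b /= bs; apply: sE; rewrite /= inE bs orbT.
  have [|n _ En] := sE a; first by rewrite /= mem_head.
  exists (maxn n N) => b /=; rewrite inE => /orP[/eqP ->|bs].
    by move: En; apply: E_mono; apply: leq_maxl.
  by apply: (E_mono N); [apply: leq_maxr|apply: sN].
have [r Er] : E N (e N).
  apply: (ideal_gen_sub (E_ideal N) sN); rewrite -Es.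
  by exists N.+1.
by exists N, r.
Qed.

(** An integral equation of [z / x], with denominators cleared.  All powers of
    [z / x] are in [I^n0 / x^n0], which is isomorphic to an ideal; a linear
    relation there expresses one power through the smaller ones. *)
Lemma fraction_integral I n0 x z : is_noetherian R -> nonzerodivisor x ->
  I x -> I z ->
  idealM (ideal_gen [set x]) (idealX I n0) = idealX I n0.+1 ->
  exists N (a : nat -> R),
    z ^+ N + \sum_(j < N) a j * x ^+ j.+1 * z ^+ (N - j.+1) = 0.
Proof.
move=> noeth xreg Ix Iz red.
have /choice[e He] : forall i, exists v, z ^+ i * x ^+ n0 = x ^+ i * v.
  move=> i; have Izx := idealXD (idealX_exp i Iz) (idealX_exp n0 Ix).
  by have [v _ ->] := idealX_factor red (leqnn n0) Izx; exists v.
have [N [r Er]] := noetherian_relation e noeth.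
pose a j := - r (N - j.+1)%N.
exists N, a; apply: (nonzerodivisor_inj (nonzerodivisorX n0 xreg)).
rewrite mulr0 mulrDr mulrC He Er [X in _ + _ * X](reindex_inj rev_ord_inj) /=.
rewrite !mulr_sumr -big_split big1 //= => i _.
have Ei : (N - i.+1).+1 = (N - i)%N by rewrite -(subSn (ltn_ord i)) subSS.
have le_iN : (i <= N)%N by apply: ltnW.
rewrite /a Ei (subKn le_iN).
have -> : x ^+ N = x ^+ (N - i) * x ^+ i by rewrite -exprD subnK.
transitivity (r i * x ^+ (N - i) * (x ^+ i * e i - z ^+ i * x ^+ n0)).
  by ring.
by rewrite He subrr mulr0.
Qed.

End PrincipalReduction.

(** * Homogenized Horner division *)

Section Horner.
Variable R : comNzRingType.
Implicit Types (I : set R) (z x s : R) (a : nat -> R).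

(** [x^m] times the [m]-th value of the Horner scheme at [z / x] for the
    coefficients [1, a 0, a 1, ...]. *)
Fixpoint horner_partial z x a m : R :=
  if m is n.+1 then z * horner_partial z x a n + a n * x ^+ n.+1 else 1.

Lemma horner_partialE z x a m :
  horner_partial z x a m =
    z ^+ m + \sum_(j < m) a j * x ^+ j.+1 * z ^+ (m - j.+1).
Proof.
elim: m => [|m IHm] /=; first by rewrite big_ord0 addr0.
rewrite IHm big_ord_recr /= subnn mulr1 mulrDr -exprS addrA mulr_sumr.
congr (_ + _ + _); apply: eq_bigr => i _.
by rewrite (subSn (ltn_ord i)) (exprS z); ring.
Qed.

Lemma horner_partial_mem I z x a m : is_ideal I -> I x -> I z ->
  idealX I m (horner_partial z x a m).
Proof.
move=> II Ix Iz; elim: m => //= m IHm.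
have [_ ID IM] := idealX_ideal I m.+1.
by apply: ID; [apply: mem_idealM|apply: IM; apply: idealX_exp].
Qed.

(** With [p] the polynomial [integral_poly] below, this is
    [x^(N-1) (p(s) - p(w)) / (s - w)] as a polynomial in [s], for
    [w = z / x]. *)
Definition horner_quotient z x a N : {poly R} :=
  \poly_(i < N) (horner_partial z x a (N - i.+1) * x ^+ i).

Definition integral_poly a N : {poly R} :=
  'X^N + \poly_(i < N) a (N - i.+1)%N.

Lemma integral_poly_neq0 (k : fieldType) (rho : {rmorphism R -> k}) a N :
  map_poly rho (integral_poly a N) != 0.
Proof.
apply/eqP => p0; have lead1 : (integral_poly a N)`_N = 1.
  by rewrite coefD coefXn eqxx coef_poly ltnn addr0.
have := oner_neq0 k.
by rewrite -(rmorph1 rho) -lead1 -coef_map p0 coef0 eqxx.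
Qed.

Lemma horner_quotientP z x a N s :
  (z - x * s) * (horner_quotient z x a N).[s] =
    horner_partial z x a N - x ^+ N * (integral_poly a N).[s].
Proof.
rewrite /horner_quotient /integral_poly hornerD hornerXn !horner_poly.
elim: N => [|N IHN]; first by rewrite !big_ord0 /=; ring.
rewrite !big_ord_recl !subSS !subn0 /= !expr0 !mulr1.
under eq_bigr => i _ do rewrite /bump add1n subSS !exprS.
under [X in x ^+ N.+1 * (_ + (_ + X))]eq_bigr => i _ do
  rewrite /bump add1n subSS exprS mulrCA.
have -> : \sum_(i < N) horner_partial z x a (N - i.+1) * (x * x ^+ i) * (s * s ^+ i)
    = x * s * \sum_(i < N) horner_partial z x a (N - i.+1) * x ^+ i * s ^+ i.
  by rewrite mulr_sumr; apply: eq_bigr => i _; ring.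
rewrite -mulr_sumr mulrDr mulrCA IHN !exprS; ring.
Qed.

End Horner.

(** * Elements of the core *)

Section Core.
Variables (R : comNzRingType) (k : fieldType) (rho : {rmorphism R -> k}).
Variables (I : set R) (x : R) (n0 : nat).
Hypothesis noeth : is_noetherian R.
Hypothesis rho_local : forall a, rho a != 0 -> invertible a.
Hypothesis pchar0 : [pchar k] =i pred0.
Hypothesis II : is_ideal I.
Hypothesis xreg : nonzerodivisor x.
Hypothesis Ix : I x.
Hypothesis red : idealM (ideal_gen [set x]) (idealX I n0) = idealX I n0.+1.

(** In terms of [w = z / x]: if [c * x] is in the core then [c w^i] is in the
    ring for all [i].  The products of [c] with the Horner partial values are
    reached first, by interpolation over the reductions generated by
    [z - x * s].  Multiplication by [w] takes each partial value to the next
    one up to an element of [R], and the last one is zero; so the span of these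
    values is stable under [w], and it contains [1]. *)
Lemma core_dvd_power c z : core I (x * c) -> I z ->
  forall i, ideal_gen [set x ^+ i] (c * z ^+ i).
Proof.
move=> core_xc Iz.
have [N [a Ea]] := fraction_integral noeth xreg Ix Iz red.
pose q := horner_partial z x a; pose h := horner_quotient z x a N.
have qN : q N = 0 by rewrite /q horner_partialE Ea.
(* Degree zero would give [1 = 0]. *)
case: N => [|N] in Ea h qN *; first by have /eqP := qN; rewrite oner_eq0.
pose p := integral_poly a N.+1.
have hp s : (z - x * s) * h.[s] = - (x ^+ N.+1 * p.[s]).
  by rewrite horner_quotientP -/(q N.+1) qN sub0r.
have h_mem s : idealX I N h.[s].
  rewrite /h /horner_quotient horner_poly; apply: ideal_sum (idealX_ideal I N) _ => i.
  apply: idealMr (idealX_ideal I N) _.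
  have -> : idealX I N = idealX I (N.+1 - i.+1 + i).
    by rewrite subSS subnK // -ltnS.
  by apply: idealXD; [apply: horner_partial_mem|apply: idealX_exp].
have [nodes [Us size_s Ds Ps]] :=
  interpolation_nodes rho_local pchar0 N.+1 (integral_poly_neq0 rho a N.+1).
have ch s : s \in nodes -> ideal_gen [set x ^+ N] (c * h.[s]).
  move=> /Ps[u pu].
  have Iy : I (z - x * s) by apply: idealB => //; apply: idealMr.
  have /(core_xc _)/ideal_gen1P[r Er] : is_reduction (ideal_gen [set z - x * s]) I.
    apply: (principal_reduction II Iy red (N := N)).
    exists (- u * h.[s]); first by case: (idealX_ideal I N) => _ _; apply.
    by rewrite mulrCA hp mulrNN mulrCA (mulrC u) pu mulr1.
  (* From [x * c = (z - x * s) * r], multiplied by [h.[s]]. *)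
  apply/ideal_gen1P; exists (- (r * p.[s])); apply: (nonzerodivisor_inj xreg).
  rewrite mulrA Er mulrAC hp exprS; ring.
have xN_ideal m : is_ideal (ideal_gen [set x ^+ m]) by apply: ideal_gen_ideal.
have coef_ch : forall j, ideal_gen [set x ^+ N] (c *: h)`_j.
  apply: (coef_ideal_of_values (xN_ideal N) Us Ds).
    by apply: leq_trans size_s; apply: leq_trans (size_scale_leq _ _) (size_poly _ _).
  by move=> s /ch; rewrite hornerZ.
have cq m : (m <= N.+1)%N -> ideal_gen [set x ^+ m] (c * q m).
  rewrite leq_eqVlt => /orP[/eqP ->|ltm].
    by rewrite qN mulr0; case: (xN_ideal N.+1).
  have := coef_ch (N - m)%N; rewrite coefZ coef_poly ltnS leq_subr.
  rewrite subSS subKn // -{1}(subnKC (ltm : m <= N)%N) exprD mulrA.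
  exact: (dvd_cancel xreg).
have cqz i : forall m, (m <= N.+1)%N -> ideal_gen [set x ^+ (m + i)] (c * q m * z ^+ i).
  elim: i => [|i IHi] m le_m; first by rewrite addn0 mulr1; apply: cq.
  move: le_m; rewrite leq_eqVlt => /orP[/eqP ->|ltm].
    by rewrite qN mulr0 mul0r; case: (xN_ideal (N.+1 + i.+1)%N).
  have -> : c * q m * z ^+ i.+1 =
      c * q m.+1 * z ^+ i - a m * (x ^+ m.+1 * (c * q 0%N * z ^+ i)).
    by rewrite /q /= exprS; ring.
  rewrite addnS -addSn; apply: idealB (xN_ideal (m.+1 + i)%N) (IHi _ ltm) _.
  case: (xN_ideal (m.+1 + i)%N) => _ _; apply.
  have /ideal_gen1P[r ->] := IHi 0%N isT.
  by apply/ideal_gen1P; exists r; rewrite mulrA -exprD.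
by move=> i; have := cqz i 0%N isT; rewrite mulr1.
Qed.

Lemma mul_mem_reduction a J :
  (forall m y, idealX I m y -> ideal_gen [set x ^+ m] (a * y)) ->
  is_reduction J I -> J (x * a).
Proof.
move=> Ka [Jideal JI [n Jred]]; have [J0 JD JM] := Jideal.
have JMa : idealM J (idealX I n) `<=`
    [set v | exists2 s, J s & a * v = x ^+ n * s].
  apply: idealM_sub.
    split=> /=; first by exists 0; rewrite ?mulr0.
      move=> v w [s Js Ev] [t Jt Ew]; exists (s + t); first exact: JD.
      by rewrite !mulrDr Ev Ew.
    move=> r v [s Js Ev]; exists (r * s); first exact: JM.
    by rewrite mulrCA Ev mulrCA.
  move=> j y Jj /Ka/ideal_gen1P[r Er]; exists (j * r).
    exact: idealMr.
  by rewrite mulrCA Er mulrCA.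
have [s Js Es] : exists2 s, J s & a * x ^+ n.+1 = x ^+ n * s.
  by apply: JMa; rewrite Jred; apply: idealX_exp.
suff -> : x * a = s by [].
apply: (nonzerodivisor_inj (nonzerodivisorX n xreg)).
by rewrite -Es exprS; ring.
Qed.

(** Polarization.  The factors of a product in [I^m] are absorbed into [g] one
    at a time, which is why the exponent [j] and the element [g] vary. *)
Lemma dvd_products_of_powers j g :
  (forall z i, I z -> ideal_gen [set x ^+ (j + i)] (g * z ^+ i)) ->
  forall m y, idealX I m y -> ideal_gen [set x ^+ (j + m)] (g * y).
Proof.
move=> + m; elim: m j g => [|m IHm] j g Hg y.
  move=> _; apply: (idealMr _ (ideal_gen_ideal _)).
  by have := Hg x 0%N Ix; rewrite mulr1.
move=> Iy; rewrite mulrC.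
have L_ideal := ideal_transporter g (ideal_gen_ideal [set x ^+ (j + m.+1)]).
apply: (idealM_sub L_ideal _ Iy) => b v Ib Iv /=.
rewrite mulrC mulrA addnS -addSn; apply: IHm Iv => z i Iz.
have one_neq0 : map_poly rho 1 != 0 by rewrite rmorph1 oner_neq0.
have [nodes [Us size_s Ds _]] :=
  interpolation_nodes rho_local pchar0 i.+2 one_neq0.
apply: (linear_coef_ideal (ideal_gen_ideal _) Us Ds size_s).
  exact: (natrS_invertible rho_local pchar0).
move=> t; rewrite addSnnS; apply: Hg.
by case: (II) => _ ID _; apply: ID => //; apply: idealMr.
Qed.

End Core.

(** * The conductor of the blowup *)

Section Blowup.
Variables (R : comNzRingType) (F : comUnitRingType) (iota : {rmorphism R -> F}).

(** The blowup consists of the fractions [y / x^m] with [y] in [I^m]: such a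
    fraction multiplies [I^n] into itself for large [n] by [idealX_factor], and
    conversely [b] in [(I^n : I^n)] equals [b x^n / x^n]. *)
Lemma conductorP (I : set R) x n0 : is_total_fraction_ring iota ->
  nonzerodivisor x -> I x ->
  idealM (ideal_gen [set x]) (idealX I n0) = idealX I n0.+1 ->
  forall a, conductor iota (blowup iota I) a <->
    forall m y, idealX I m y -> ideal_gen [set x ^+ m] (a * y).
Proof.
move=> [iota_inj iota_unit _] xreg Ix red a.
have ux n : iota (x ^+ n) \is a GRing.unit.
  by apply: iota_unit; apply: nonzerodivisorX.
split=> [Ka m y Iy | Ha b [n _ colon_b]].
  have [|r _ Er] := Ka (iota y / iota (x ^+ m)).
    (* The successor keeps the exponent positive. *)
    exists n0.+1 => // v Iv.
    have [w Iw Ew] := idealX_factor red (leqnSn n0) (idealXD Iy Iv).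
    by exists w; rewrite // mulrAC -rmorphM Ew rmorphM mulrC mulKr.
  apply/ideal_gen1P; exists r; apply: iota_inj.
  by rewrite !rmorphM /= Er mulrCA [iota (x ^+ m) * _]mulrC divrK.
have [y Iy Ey] := colon_b _ (idealX_exp n Ix).
have /ideal_gen1P[r Er] := Ha n y Iy.
exists r => //; apply: (mulrI (ux n)).
by rewrite -rmorphM -Er rmorphM Ey mulrA mulrC.
Qed.

End Blowup.

(** * The core of the ideal *)

(** The depth equals the dimension, so a regular sequence of length one lies in
    [M]. *)
Lemma cohen_macaulay_dim1_regular (R : comNzRingType) (M : set R) :
  krull_dim_eq R 1 -> is_cohen_macaulay M -> exists2 e, M e & nonzerodivisor e.
Proof.
move=> [[p Hp] dim1] [d [[[p' Hp'] dimd] [[s [size_s sM [sreg _]]] _]]].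
have d1 : d = 1%N by apply/eqP; rewrite eqn_leq (dim1 _ _ Hp') (dimd _ _ Hp).
move: size_s sM sreg; rewrite d1; case: s => [|e []] //= _ sM sreg.
exists e; first by apply: sM; rewrite /= mem_head.
have gen0 r : ideal_gen [set` [::]] r -> r = 0.
  apply: (@ideal_gen_sub _ _ [set 0]) => //; split=> //=.
    by move=> _ _ -> ->; rewrite addr0.
  by move=> r' _ ->; rewrite mulr0.
move=> b eb0; apply: gen0; apply: (sreg 0%N b) => //=.
by rewrite eb0; case: (ideal_gen_ideal [set` [::] : seq R]).
Qed.

Theorem theorem3p2 (R : comNzRingType) (M : set R)
    (k : fieldType) (rho : {rmorphism R -> k})
    (F : comUnitRingType) (iota : {rmorphism R -> F})
    (I : set R) (x : R) :
  is_noetherian R ->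
  is_local_ring M ->
  krull_dim_eq R 1 ->
  is_cohen_macaulay M ->
  is_residue_field M rho ->
  [pchar k] =i pred0 ->
  is_total_fraction_ring iota ->
  is_primary_to M I ->
  I x ->
  is_minimal_reduction (ideal_gen [set x]) I ->
  let K := conductor iota (blowup iota I) in
  core I = [set x * a | a in K] /\ [set x * a | a in K] = idealM I K.
Proof.
move=> noeth Mlocal dim1 CM [_ kerM] pchar0 fracF [[[II _] _] radI] Ix.
move=> [xred _] K; have [_ _ [n0 red]] := xred.
have rho_local a : rho a != 0 -> invertible a.
  by move=> ra; apply: (local_invertible Mlocal) => /kerM ra0; rewrite ra0 eqxx in ra.
have xreg : nonzerodivisor x.
  have [e Me ereg] := cohen_macaulay_dim1_regular dim1 CM.
  move: Me; rewrite -radI => -[n Ien].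
  have [v _ Ev] := mem_reduction_ideal
    (eq_ind_r (fun A : set R => A _) (idealX_exp n0.+1 Ien) red).
  move=> b xb0; apply: (nonzerodivisorX n0.+1 (nonzerodivisorX n ereg)).
  by rewrite Ev mulrAC xb0 mul0r.
have KP := conductorP fracF xreg Ix red; rewrite -/K in KP.
have K_ideal : is_ideal K.
  have gid m := ideal_gen_ideal [set x ^+ m].
  split.
  - by apply/KP => m y _; rewrite mul0r; case: (gid m).
  - move=> a b /KP Ka /KP Kb; apply/KP => m y Iy; rewrite mulrDl.
    by case: (gid m) => _ GD _; apply: GD; [apply: Ka|apply: Kb].
  - move=> r a /KP Ka; apply/KP => m y Iy; rewrite -mulrA.
    by case: (gid m) => _ _; apply; apply: Ka.
split; apply/seteqP; split.
- move=> d core_d; have /ideal_gen1P[c Ed] := core_d _ xred.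
  exists c => //; apply/KP; rewrite {d}Ed in core_d.
  apply: (dvd_products_of_powers rho_local pchar0 II Ix (j := 0)) => z i Iz.
  exact: (core_dvd_power noeth rho_local pchar0 II xreg Ix red core_d Iz).
- move=> _ [a /KP Ka <-] J Jred.
  exact: (mul_mem_reduction xreg Ix Ka Jred).
- by move=> _ [a Ka <-]; apply: mem_idealM.
- apply: idealM_sub.
    case: (K_ideal) => K0 KD KM; split.
    + by exists 0; rewrite ?mulr0.
    + by move=> _ _ [a Ka <-] [b Kb <-]; exists (a + b); [apply: KD|rewrite mulrDr].
    + by move=> r _ [a Ka <-]; exists (r * a); [apply: KM|rewrite mulrCA].
  move=> i a Ii /KP Ka; have /ideal_gen1P[r Er] := Ka 1%N i (idealX1 Ii).
  exists r; last by rewrite [RHS]mulrC Er.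
  apply/KP => m y Iy.
  have := Ka m.+1 _ (mem_idealM Ii Iy).
  rewrite (mulrA a i) Er -mulrA [x ^+ 1 * _]mulrC -addn1 exprD.
  exact: dvd_cancel.
Qed.
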